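(* Let $R$ be an associative ring with identity such that the pure-injective envelope of every flat left $R$-module is flat, and let $\mathbf{K}^{\mathcal{F}}$ denote the class of flat left $R$-modules with pure embeddings. Let $M, N_1, N_2 \in \mathbf{K}^{\mathcal{F}}$ with $M \leq_{pp} N_1$ and $M \leq_{pp} N_2$, and let $\bar{b}_{1} \in N_1^{<\omega}$ and $\bar{b}_{2} \in N_2^{<\omega}$. Then \[ \mathbf{gtp}(\bar{b}_{1}/M; N_1) = \mathbf{gtp}(\bar{b}_{2}/M; N_2) \quad\text{if and only if}\quad pp(\bar{b}_{1}/M , N_1) = pp(\bar{b}_{2}/M, N_2).\]
   Context: $\leq_{pp}$ is the pure submodule relation; a pure embedding is an isomorphism onto a pure submodule; $N^{<\omega}$ is the set of finite tuples from $N$. Galois-types in $\mathbf{K}^{\mathcal{F}}$: consider triples $(\bar b, A, N)$ with $N$ a flat left $R$-module, $A \subseteq N$ and $\bar b$ a sequence of elements of $N$. Set $(\bar b_1, A_1, N_1) E_{at} (\bar b_2, A_2, N_2)$ if $A_1 = A_2 =: A$ and there are a flat left $R$-module $N$ and pure embeddings $f_\ell : N_\ell \to N$ ($\ell = 1,2$) fixing $A$ pointwise such that $f_1(\bar b_1) = f_2(\bar b_2)$. Let $E$ be the transitive closure of $E_{at}$. Then $\mathbf{gtp}(\bar b/A; N)$ is the $E$-equivalence class of $(\bar b, A, N)$. A $pp$-formula is an existentially quantified finite system of $R$-linear equations. For a module $N$, $\bar a \in N^{<\omega}$ and $B \subseteq N$, the $pp$-type $pp(\bar a/B, N)$ is the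 set of $pp$-formulas $\phi(\bar x, \bar b)$ with parameters $\bar b$ from $B$ such that $N$ satisfies $\phi(\bar a, \bar b)$. *)

(* Defs.v *)
From HB Require Import structures.
From mathcomp Require Import all_boot all_algebra.
From mathcomp Require Import boolp classical_sets.
From Stdlib Require Import Relations.Relation_Operators.

Set Implicit Arguments.
Unset Strict Implicit.
Unset Printing Implicit Defensive.

Import GRing.Theory.

Local Open Scope classical_set_scope.
Local Open Scope ring_scope.

(* [lmodType R] is the type of left R-modules.  Right R-modules are left
   modules over the converse ring [R^c]: [r *: a] stands for [a r]. *)

(* The tensor product of a right module A and a left module F, presented as
   finite formal sums of elementary tensors modulo the least congruence making
   the elementary tensor biadditive and R-balanced.  No formal negatives are
   needed, since [- (a (x) y) = (- a) (x) y]. *)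
Inductive tensor_eq (R : pzRingType) (A : lmodType R^c) (F : lmodType R) :
    seq (A * F) -> seq (A * F) -> Prop :=
| tensor_refl s : tensor_eq s s
| tensor_sym s t : tensor_eq s t -> tensor_eq t s
| tensor_trans s t u : tensor_eq s t -> tensor_eq t u -> tensor_eq s u
| tensor_cat s s' t t' :
    tensor_eq s s' -> tensor_eq t t' -> tensor_eq (s ++ t) (s' ++ t')
| tensor_comm s t : tensor_eq (s ++ t) (t ++ s)
| tensor_zero (x : F) : tensor_eq [:: (0, x)] [::]
| tensor_addl (a a' : A) (x : F) :
    tensor_eq [:: (a + a', x)] [:: (a, x); (a', x)]
| tensor_addr (a : A) (x x' : F) :
    tensor_eq [:: (a, x + x')] [:: (a, x); (a, x')]
| tensor_balanced (r : R) (a : A) (x : F) :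
    tensor_eq [:: ((r : R^c) *: a, x)] [:: (a, r *: x)].

(* Tensoring with F preserves injectivity; the conclusion is injectivity of
   [f (x) id_F] (right exactness of the tensor product being automatic). *)
Definition flat (R : pzRingType) (F : lmodType R) : Prop :=
  forall (A B : lmodType R^c) (f : {linear A -> B}), injective f ->
  forall s t : seq (A * F),
    tensor_eq [seq (f p.1, p.2) | p <- s] [seq (f p.1, p.2) | p <- t] ->
    tensor_eq s t.

(* The pp-formula  exists w, free * v + bound * w = 0  in n free variables v. *)
Record pp_formula (R : pzRingType) (n : nat) := PPFormula {
  pp_nbound : nat;
  pp_neqs : nat;
  pp_free : 'M[R]_(pp_neqs, n);
  pp_bound : 'M[R]_(pp_neqs, pp_nbound) }.

Definition pp_sat (R : pzRingType) (n : nat) (N : lmodType R)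
    (phi : pp_formula R n) (v : n.-tuple N) : Prop :=
  exists w : (pp_nbound phi).-tuple N, forall e : 'I_(pp_neqs phi),
    \sum_(i < n) pp_free phi e i *: tnth v i +
    \sum_(j < pp_nbound phi) pp_bound phi e j *: tnth w j = 0.

Definition pure_embedding (R : pzRingType) (M N : lmodType R)
    (f : {linear M -> N}) : Prop :=
  injective f /\
  forall (n : nat) (phi : pp_formula R n) (v : n.-tuple M),
    pp_sat phi (map_tuple f v) -> pp_sat phi v.

Definition pure_injective (R : pzRingType) (P : lmodType R) : Prop :=
  forall (A B : lmodType R) (f : {linear A -> B}) (g : {linear A -> P}),
    pure_embedding f -> exists h : {linear B -> P}, forall a, h (f a) = g a.

(* P, with i : M -> P, is a minimum pure-injective pure extension of M; this
   determines P up to isomorphism over M. *)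
Definition pure_injective_envelope (R : pzRingType) (M P : lmodType R)
    (i : {linear M -> P}) : Prop :=
  [/\ pure_embedding i, pure_injective P &
    forall (N : lmodType R) (j : {linear M -> N}),
      pure_embedding j -> pure_injective N ->
      exists2 g : {linear P -> N}, pure_embedding g & forall m, g (i m) = j m].

(* A formula phi(x, c) with x of length [ppo_arity] and parameters c in A. *)
Record pp_over (R : pzRingType) (A : Type) := PPOver {
  ppo_arity : nat;
  ppo_nparams : nat;
  ppo_formula : pp_formula R (ppo_arity + ppo_nparams);
  ppo_params : ppo_nparams.-tuple A }.

(* The parameter set is a type A together with its inclusion [inc] into N, so
   that one A can be a subset of several modules. *)
Definition pp_type (R : pzRingType) (A : Type) (N : lmodType R)
    (inc : A -> N) (b : seq N) : set (pp_over R A) :=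
  [set p | exists2 x : (ppo_arity p).-tuple N, x = b :> seq N &
     pp_sat (ppo_formula p) (cat_tuple x (map_tuple inc (ppo_params p)))].

(* The triples (b, A, N), for a fixed A, and finite b. *)
Record triple (R : pzRingType) (A : Type) := Triple {
  tr_mod : lmodType R;
  tr_flat : flat tr_mod;
  tr_inc : A -> tr_mod;
  tr_inc_inj : injective tr_inc;
  tr_tuple : seq tr_mod }.

(* Both maps fix A pointwise: A is a subset of N through the common value of
   [f1 \o inc1] and [f2 \o inc2]. *)
Definition Eat (R : pzRingType) (A : Type) (t1 t2 : triple R A) : Prop :=
  exists (N : lmodType R)
      (f1 : {linear tr_mod t1 -> N}) (f2 : {linear tr_mod t2 -> N}),
    [/\ flat N, pure_embedding f1, pure_embedding f2,
        forall a : A, f1 (tr_inc t1 a) = f2 (tr_inc t2 a) &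
        map f1 (tr_tuple t1) = map f2 (tr_tuple t2)].

(* The E-class of (b, A, N), extensionally a predicate on triples: the triples
   form a type too large for [set]. *)
Definition gtp (R : pzRingType) (A : Type) (N : lmodType R) (N_flat : flat N)
    (inc : A -> N) (inc_inj : injective inc) (b : seq N) : triple R A -> Prop :=
  fun t => clos_trans _ (@Eat R A) (Triple N_flat inc_inj b) t.

(* Main.v *)
Require Import Defs.
From HB Require Import structures.
From mathcomp Require Import all_boot all_algebra all_field.
From mathcomp Require Import boolp classical_sets functions filter.
From Stdlib Require Import Relations.Relation_Operators.

Set Implicit Arguments.
Unset Strict Implicit.
Unset Printing Implicit Defensive.

Import GRing.Theory Num.Theory.
Local Open Scope classical_set_scope.
Local Open Scope ring_scope.

(** A pure embedding preserves and reflects pp-formulas, so a chain of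
    amalgamations keeps the pp-type of the tuple; hence equal Galois-types give
    equal pp-types.

    Conversely, let the pp-types of [b1] and [b2] over [M] agree.  Embed N1 and
    N2 in pure-injective envelopes P1 and P2, which are flat.  Equality of the
    pp-types says that the correspondence sending [i2 m] to [i1 m] and the
    entries of [b2] to those of [b1] preserves pp-formulas, and partial maps of
    this kind into a pure-injective module extend to the whole domain.  So the
    embedding e1 : N1 -> P1 has a companion g1 : N2 -> P1 that agrees with it on
    [M] and on the tuples, and e2 : N2 -> P2 has a companion g2 : N1 -> P2.  The
    maps (e1, g2) and (g1, e2) into P1 * P2 agree on [M] and on the tuples.
    They are pure, because one coordinate of each is pure, and P1 * P2 is flat
    as a direct sum of flat modules.  A pushout of N1 and N2 over the submodule
    generated by [M] and the tuples would also receive both modules purely, but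
    it need not be flat.

    It remains to construct envelopes, in the sense of
    [pure_injective_envelope].  The working notion is [has_limits]: along every
    proper filter there is a linear limit functional for families with values
    in P, which sends an eventually constant family to its value.
    A system of equations that is finitely solvable in P is then solved by the
    limit of its partial solutions, so that P is [pp_injective]
    ([limits_pp_injective]), and in particular pure-injective.  The
    double character module of M, with values in a divisible cogenerator, has
    limits and contains M purely ([exists_pure_extension_with_limits]).

    To cut such an extension Q down to an envelope, consider the endomorphisms
    of Q over M.  Limits and Zorn's lemma provide one, e, such that the set of
    pp-conditions satisfied after applying e is as large as possible.  Every
    endomorphism over M then reflects pp-formulas on the image of e.  A
    subset B that contains this image and is maximal with this property turns
    out to be the image of an idempotent ([exists_retraction]).  It is the
    envelope: it has limits, being a retract of Q, and a map from B that is
    pure on M composes with an extension back to Q to give an endomorphism over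
    M, so it reflects pp-formulas. *)

(** * Bundled maps and Zorn's lemma *)

Lemma linear_of (R : pzRingType) (U V : lmodType R) (f : U -> V) :
  (forall r x y, f (r *: x + y) = r *: f x + f y) ->
  exists g : {linear U -> V}, forall x, g x = f x.
Proof.
move=> fP; pose g : {linear U -> V} :=
  HB.pack f (GRing.isLinear.Build R U V *:%R f fP).
by exists g.
Qed.

Lemma additive_of (U V : zmodType) (f : U -> V) :
  (forall x y, f (x - y) = f x - f y) ->
  exists g : {additive U -> V}, forall x, g x = f x.
Proof.
move=> fP; pose g : {additive U -> V} :=
  HB.pack f (GRing.isZmodMorphism.Build U V f fP).
by exists g.
Qed.

(** Restricts the maximal set of Zorn's lemma to lie above a given one, so that
    only nonempty chains have to be bounded. *)
Lemma Zorn_above T (P : set (set T)) (A0 : set T) : P A0 ->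
  (forall F : set (set T), F !=set0 -> F `<=` P -> total_on F subset ->
     P (\bigcup_(X in F) X)) ->
  exists A, [/\ P A, A0 `<=` A & forall B, P B -> A `<=` B -> B `<=` A].
Proof.
move=> PA0 Pchain.
have [F FP Ftot|A [PA Amax]] := @Zorn_bigcup T (fun B => P (A0 `|` B)).
  have [->|/set0P F0] := eqVneq F set0; first by rewrite bigcup_set0 setU0.
  have -> : A0 `|` \bigcup_(X in F) X =
            \bigcup_(Y in [set A0 `|` X | X in F]) Y.
    rewrite bigcup_image; apply/seteqP; split=> x.
      move=> [A0x|[X FX Xx]]; last by exists X => //; right.
      by have [X FX] := F0; exists X => //; left.
    by move=> [X FX [A0x|Xx]]; [left|right; exists X].
  apply: Pchain.
  - by have [X FX] := F0; exists (A0 `|` X); exists X.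
  - by move=> _ [X FX <-]; apply: FP.
  - move=> _ _ [X FX <-] [Y FY <-].
    by have [XY|YX] := Ftot X Y FX FY; [left|right]; apply: setUS.
have A0A : A0 `<=` A.
  apply: (@contrapT (A0 `<=` A)) => A0A.
  apply: (Amax (A0 `|` A)); last by rewrite setUA setUid.
  by split=> [|A0AA]; [apply: subsetUr|apply: A0A => x A0x; apply: A0AA; left].
exists A; split => //; first by rewrite -(setUidr A0A).
move=> B PB AB; apply: (@contrapT (B `<=` A)) => BA; apply: (Amax B); first by split.
by rewrite setUidr //; apply: subset_trans AB.
Qed.

(** The same convenience for a preorder: nonempty chains suffice once the
    order has some element. *)
Lemma ZL_preorder_prop (T : Type) (t0 : T) (le : T -> T -> Prop) :
  (forall t, le t t) -> (forall r s t, le r s -> le s t -> le r t) ->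
  (forall A : set T, A !=set0 -> total_on A le ->
     exists t, forall s, A s -> le s t) ->
  exists t, forall s, le t s -> le s t.
Proof.
move=> le_refl le_trans chain.
have [||A Atot|t tmax] := @ZL_preorder T t0 (fun s t => `[< le s t >]).
- by move=> t; apply/asboolP.
- by move=> r s t /asboolP rs /asboolP st; apply/asboolP; apply: le_trans st.
- have [->|/set0P A0] := eqVneq A set0; first by exists t0.
  have [|t tP] := chain A A0.
    by move=> s t As At; case: (Atot s t As At) => /asboolP; [left|right].
  by exists t => s As; apply/asboolP/tP.
- by exists t => s /asboolP ts; apply/asboolP; apply: tmax.
Qed.

Lemma total_on_finite T (A : set T) (le : T -> T -> Prop) n (P : 'I_n -> T -> Prop) :
  A !=set0 -> total_on A le -> (forall k x y, le x y -> P k x -> P k y) ->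
  (forall k, exists2 x, A x & P k x) -> exists2 x, A x & forall k, P k x.
Proof.
move=> A0 Atot Pmono Pex.
suff [x Ax xP] : exists2 x, A x & forall k, k \in enum 'I_n -> P k x.
  by exists x => // k; apply: xP; rewrite mem_enum.
elim: (enum _) => [|k s [x Ax xP]]; first by case: A0 => x Ax; exists x.
have [y Ay yP] := Pex k; have [xy|yx] := Atot x y Ax Ay.
  exists y => // j; rewrite inE => /orP[/eqP->//|js].
  by apply: Pmono xy _; apply: xP.
exists x => // j; rewrite inE => /orP[/eqP->|/xP //].
exact: Pmono yx _.
Qed.

(** * Characters of abelian groups *)

(** A root [c] of [c *+ n = d] can even be chosen nonzero: besides making C
    divisible, this produces torsion of every order, so that characters with
    values in C separate points.  The case [n = 0], where [d] must be 0, covers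
    elements of infinite order; for [n = 1] the root is d itself. *)
Definition cogenerating (C : zmodType) : Prop :=
  forall (n : nat) (d : C), n != 1%N -> (n = 0%N -> d = 0) ->
  exists2 c : C, c != 0 & c *+ n = d.

(** The multiplicative group of the field of algebraic numbers, written
    additively.  It is divisible since the field is algebraically closed, and
    it contains all roots of unity. *)
Record algU := AlgU { algU_val : algC; algU_neq0 : algU_val != 0 }.
HB.instance Definition _ := [isSub for algU_val].
HB.instance Definition _ := [Choice of algU by <:].

Definition algU_one := AlgU (oner_neq0 algC).
Definition algU_mul (x y : algU) := AlgU (mulf_neq0 (valP x) (valP y)).
Definition algU_inv (x : algU) := AlgU (invr_neq0 (valP x)).

Lemma algU_mulA : associative algU_mul.
Proof. by move=> x y z; apply: val_inj; rewrite /= mulrA. Qed.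
Lemma algU_mulC : commutative algU_mul.
Proof. by move=> x y; apply: val_inj; rewrite /= mulrC. Qed.
Lemma algU_mul1 : left_id algU_one algU_mul.
Proof. by move=> x; apply: val_inj; rewrite /= mul1r. Qed.
Lemma algU_mulV : left_inverse algU_one algU_inv algU_mul.
Proof. by move=> x; apply: val_inj; rewrite /= mulVf // (valP x). Qed.
HB.instance Definition _ :=
  GRing.isZmodule.Build algU algU_mulA algU_mulC algU_mul1 algU_mulV.

Lemma algU_valMn (x : algU) n : val (x *+ n) = val x ^+ n.
Proof. by elim: n => [|n IHn] //=; rewrite mulrS exprS -IHn. Qed.

Lemma algU_cogenerating : cogenerating algU.
Proof.
move=> n d n1 nd; have [n0|n_gt0] := posnP n.
  have N1 : (- 1 : algC) != 0 by rewrite oppr_eq0 oner_eq0.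
  exists (AlgU N1); last by rewrite n0 nd.
  by rewrite -val_eqE /= eq_sym -addr_eq0 -(natrD _ 1 1) pnatr_eq0.
(* The neutral element is the number 1: its nontrivial root is a root of unity,
   while every root of another number is nontrivial. *)
have [d1|d_neq1] := eqVneq d 0.
  have [z z_prim] := C_prim_root_exists n_gt0.
  have z0 : z != 0.
    apply/eqP => z0; have /eqP := prim_expr_order z_prim.
    by rewrite z0 expr0n gtn_eqF // eq_sym oner_eq0.
  exists (AlgU z0); last first.
    by apply: val_inj; rewrite algU_valMn d1 /= prim_expr_order.
  rewrite -val_eqE /=; apply: contra n1 => /eqP z1.
  by rewrite -dvdn1 (prim_order_dvd z_prim) z1 expr1n.
have r0 : n.-root (val d) != 0 by rewrite rootC_eq0 // (valP d).
have rn : AlgU r0 *+ n = d by apply: val_inj; rewrite algU_valMn /= rootCK.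
exists (AlgU r0) => //; apply: contraNneq d_neq1 => r1.
by rewrite -rn r1 mul0rn.
Qed.

Section Characters.
Variables (G C : zmodType).
Hypothesis C_cogen : cogenerating C.

(** A homomorphism to C defined on a subgroup of G, given by its graph. *)
Definition partial_hom (g : set (G * C)) : Prop :=
  [/\ g (0, 0),
      forall x y c d, g (x, c) -> g (y, d) -> g (x - y, c - d) &
      forall c, g (0, c) -> c = 0].

Lemma partial_homMz g x c (k : int) :
  partial_hom g -> g (x, c) -> g (x *~ k, c *~ k).
Proof.
move=> [g0 gB _] gp; have gN y d : g (y, d) -> g (- y, - d).
  by move=> gq; have := gB _ _ _ _ g0 gq; rewrite !add0r.
have gn n : g (x *+ n, c *+ n).
  elim: n => [|n IHn]; first by rewrite !mulr0n.
  by have := gB _ _ _ _ IHn (gN _ _ gp); rewrite !opprK -!mulrSr.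
case: k => n; [exact: gn|rewrite NegzE !mulrNz; exact/gN/gn].
Qed.

(** The integers k with [x *~ k] in the domain form an ideal, generated by some
    [n <> 1].  An extension to x is determined by a value c with [c *+ n] equal
    to the prescribed value d at [x *+ n]; a nonzero c exists because C is
    cogenerating. *)
Lemma partial_hom_adjoin (g : set (G * C)) x : partial_hom g ->
  (forall c, ~ g (x, c)) ->
  exists2 c, c != 0 & exists2 g', partial_hom g' & g `<=` g' /\ g' (x, c).
Proof.
move=> gP gx; have [g0 gB gf] := gP.
pose dom k := exists c, g (x *~ k, c).
(* n = 0 if no positive multiple of x lies in the domain. *)
have [n n_dvd [d gnd]] : exists2 n : nat,
    forall k : int, dom k -> exists q : int, k = q * n%:Z & dom n%:Z.
  have [[n0 n0P]|no_pos] := pselect (exists n : nat, `[< dom n.+1%:Z >]).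
    have exP : exists n : nat, `[< dom n.+1%:Z >] by exists n0.
    case: (ex_minnP exP) => m /asboolP dm m_min; exists m.+1 => // k [c gc].
    exists (k %/ m.+1%:Z)%Z.
    suff r0 : (k %% m.+1%:Z)%Z = 0 by rewrite {1}(divz_eq k m.+1%:Z) r0 addr0.
    have : (0 <= k %% m.+1%:Z)%Z by rewrite modz_ge0.
    have : (k %% m.+1%:Z < m.+1%:Z)%Z by rewrite ltz_mod.
    case rE: (k %% m.+1%:Z)%Z => [[|r]|//] //; rewrite ltz_nat ltnS => rm _.
    suff /m_min : `[< dom r.+1%:Z >] by rewrite leqNgt rm.
    apply/asboolP; have [d gd] := dm.
    exists (c - d *~ (k %/ m.+1%:Z)%Z).
    rewrite -rE; have -> : (k %% m.+1%:Z)%Z = k - m.+1%:Z * (k %/ m.+1%:Z)%Z.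
      by rewrite {2}(divz_eq k m.+1%:Z) mulrC addrC addKr.
    rewrite mulrzBr mulrzA.
    by have := gB _ _ _ _ gc (partial_homMz (k %/ m.+1%:Z)%Z gP gd).
  exists 0%N; last by exists 0; rewrite mulr0z.
  have dom_neg n : ~ dom n.+1%:Z.
    by move=> dn; apply: no_pos; exists n; apply/asboolP.
  move=> k [c gc]; exists 0; rewrite mul0r; case: k gc => [[|n]|n] gc.
  - by [].
  - by case: (dom_neg n); exists c.
  - case: (dom_neg n); exists (- c).
    by have := partial_homMz (- 1) gP gc; rewrite NegzE !mulrNz !mulr1z opprK.
have n1 : n != 1%N by apply/eqP => n1; apply: (gx d); rewrite n1 in gnd.
have [c c0 cn] : exists2 c : C, c != 0 & c *+ n = d.
  by apply: C_cogen => // n0; apply: gf; rewrite n0 mulr0z in gnd.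
exists c => //; exists [set p | exists k : int, g (p.1 - x *~ k, p.2 - c *~ k)].
  split.
  - by exists 0; rewrite /= !mulr0z !subr0.
  - move=> y z a b [k /= gk] [l /= gl]; exists (k - l) => /=.
    have := gB _ _ _ _ gk gl; congr (g (_, _)).
      by rewrite mulrzBr (opprD z) addrACA -opprD.
    by rewrite mulrzBr (opprD b) addrACA -opprD.
  - move=> c' [k /= gk]; have [q kq] : exists q : int, k = q * n%:Z.
      apply: n_dvd; have := partial_homMz (-1) gP gk; rewrite !mulrNz !mulr1z sub0r opprK.
      by exists (- (c' - c *~ k)).
    have := gB _ _ _ _ gk (partial_homMz (- q) gP gnd).
    have -> : x *~ n%:Z *~ (- q) = - (x *~ k) by rewrite mulrNz kq mulrC mulrzA.
    have -> : d *~ (- q) = - (c *~ k) by rewrite mulrNz kq mulrC mulrzA -cn.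
    by rewrite sub0r subrr opprK subrK => /gf.
split.
  by move=> p gp; exists 0; rewrite /= !mulr0z !subr0; case: p gp.
by exists 1; rewrite /= !mulr1z !subrr.
Qed.

(** The graph of a maximal extension has full domain, since otherwise
    [partial_hom_adjoin] would enlarge it. *)
Lemma hom_extension (g : set (G * C)) : partial_hom g ->
  exists f : {additive G -> C}, forall x c, g (x, c) -> f x = c.
Proof.
move=> gP; have [F F0 FP Ftot|m [mP gm m_max]] := Zorn_above gP.
  have [X0 FX0] := F0; split.
  - by exists X0 => //; have [] := FP _ FX0.
  - move=> x y c d [X FX Xxc] [Y FY Yyd].
    have [XY|YX] := Ftot _ _ FX FY.
      by exists Y => //; have [_ YB _] := FP _ FY; apply: YB => //; apply: XY.
    by exists X => //; have [_ XB _] := FP _ FX; apply: XB => //; apply: YX.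
  - by move=> c [X FX]; have [_ _] := FP _ FX; apply.
have [m0 mB mf] := mP.
have /choice[f fP] x : exists c, m (x, c).
  apply: contrapT => mx.
  have [|c _ [m' m'P [mm' m'xc]]] := partial_hom_adjoin (x := x) mP.
    by move=> c mxc; apply: mx; exists c.
  by apply: mx; exists c; apply: m_max m'xc.
have m_fun x c : m (x, c) -> f x = c.
  by move=> mxc; apply/eqP; rewrite -subr_eq0; apply/eqP/mf;
    rewrite -(subrr x); apply: mB.
have [|h hf] := additive_of (f := f).
  by move=> x y; apply: m_fun; apply: mB.
by exists h => x c /gm mxc; rewrite hf; apply: m_fun.
Qed.

(** Extends the zero homomorphism on H by a nonzero value at x. *)
Lemma hom_separation (H : set G) x :
  H 0 -> (forall y z, H y -> H z -> H (y - z)) -> ~ H x ->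
  exists f : {additive G -> C}, (forall y, H y -> f y = 0) /\ f x != 0.
Proof.
move=> H0 HB Hx; pose g : set (G * C) := [set p | H p.1 /\ p.2 = 0].
have gP : partial_hom g.
  split=> [//|y z c d [/= Hy ->] [/= Hz ->]|c [] //].
  by split; [apply: HB|rewrite /= subrr].
have [|c c0 [g' g'P [gg' g'x]]] := partial_hom_adjoin (x := x) gP.
  by move=> c [].
have [f ff] := hom_extension g'P; exists f; split; last by rewrite (ff _ _ g'x).
by move=> y Hy; apply: ff; apply: gg'.
Qed.

End Characters.

(** Eventually constant families form a subgroup on which the limit is already
    a homomorphism, well defined because the filter is proper; injectivity of C
    extends it to all families. *)
Lemma additive_limit (C : zmodType) (D : Type) (F : set_system D) :
  cogenerating C -> ProperFilter F ->
  exists L : {additive (D -> C) -> C},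
    forall z c, (\forall d \near F, z d = c) -> L z = c.
Proof.
move=> C_cogen FF.
pose g : set ((D -> C) * C) := [set p | \forall d \near F, p.1 d = p.2].
have [|L LP] := hom_extension C_cogen (g := g); last by exists L => z c zc; apply: LP.
split.
- exact: nearW.
- by move=> y z c d /= yc zd; near=> t; rewrite !fctE; congr (_ - _); near: t.
- by move=> c c0; have [d] := filter_ex c0.
Unshelve. all: by end_near.
Qed.

(** * pp-formulas and limits *)

Section PP.
Variable R : pzRingType.

(** [pp_sat] with functions in place of tuples: composition with maps between
    modules, or between index sets, is then composition of functions. *)
Definition sat n (N : lmodType R) (phi : pp_formula R n) (v : 'I_n -> N) : Prop :=
  exists w : 'I_(pp_nbound phi) -> N, forall e,
    \sum_i pp_free phi e i *: v i + \sum_j pp_bound phi e j *: w j = 0.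

Lemma pp_satP n (N : lmodType R) (phi : pp_formula R n) (v : n.-tuple N) :
  pp_sat phi v <-> sat phi (tnth v).
Proof.
split=> [[w wP]|[w wP]]; first by exists (tnth w).
exists [tuple w j | j < _] => e; rewrite -[RHS](wP e); congr (_ + _).
by apply: eq_bigr => j _; rewrite tnth_mktuple.
Qed.

Lemma sat_linear n (N N' : lmodType R) (f : {linear N -> N'})
    (phi : pp_formula R n) (v : 'I_n -> N) :
  sat phi v -> sat phi (f \o v).
Proof.
move=> [w wP]; exists (f \o w) => e.
rewrite -[RHS](linear0 f) -(wP e) linearD !linear_sum.
by congr (_ + _); apply: eq_bigr => i _; rewrite linearZ.
Qed.

(** Injectivity is the case of the formula [v = 0]. *)
Lemma pure_embeddingP (M N : lmodType R) (f : {linear M -> N}) :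
  pure_embedding f <->
  forall n (phi : pp_formula R n) (v : 'I_n -> M), sat phi (f \o v) -> sat phi v.
Proof.
split=> [[_ fP] n phi v vP|fP].
  have tv : tnth [tuple v i | i < n] = v.
    by apply: funext => i; rewrite tnth_mktuple.
  rewrite -tv; apply/pp_satP/fP/pp_satP.
  suff -> : tnth (map_tuple f [tuple v i | i < n]) = f \o v by [].
  by apply: funext => i; rewrite tnth_map tnth_mktuple.
split=> [|n phi v /pp_satP vP]; last first.
  apply/pp_satP/fP; suff <- : tnth (map_tuple f v) = f \o tnth v by [].
  by apply: funext => i; rewrite tnth_map.
apply: raddf_inj => x fx0.
pose phi : pp_formula R 1 := @PPFormula R 1 0 1 1%:M 0.
have [|w /(_ ord0)] := fP _ phi (fun=> x).
  exists (fun=> 0) => e; rewrite big_ord0 big_ord1 /= fx0 scaler0 addr0 //.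
by rewrite big_ord1 big_ord0 mxE /= scale1r addr0.
Qed.

(** A relation is used rather than a function so that a partial map can be
    described by matching generators; that it is
    single-valued follows from the formula [v_0 - v_1 = 0]. *)
Definition pp_preserving (X P : lmodType R) (g : X -> P -> Prop) : Prop :=
  forall n (phi : pp_formula R n) (v : 'I_n -> X) (w : 'I_n -> P),
    (forall i, g (v i) (w i)) -> sat phi v -> sat phi w.

Definition pp_injective (P : lmodType R) : Prop :=
  forall (X : lmodType R) (g : X -> P -> Prop), g 0 0 -> pp_preserving g ->
  exists h : {linear X -> P}, forall x p, g x p -> h x = p.

(** A form of algebraic compactness.  Limits along the filter of finite
    subsystems turn partial solutions of a system of linear equations into a
    solution, and limits along a chain of endomorphisms bound the chain. *)
Definition has_limits (P : lmodType R) : Prop :=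
  forall (D : Type) (F : set_system D), ProperFilter F ->
  exists L : {linear (D -> P) -> P},
    forall z c, (\forall d \near F, z d = c) -> L z = c.

(** [(s, p)] stands for the equation [\sum_(x <- s) x.1 *: u x.2 = p] in the
    unknown values of u, where [x.1] is a scalar and [x.2] the argument of u. *)
Definition equation (X P : lmodType R) := (seq (R * X) * P)%type.

(** The solvability of a finite system, as a condition on its right-hand sides,
    is a pp-formula.  In X the identity is a solution, with right-hand sides
    that g relates to the given ones; so a pp-preserving g transfers
    solvability to P. *)
Lemma locally_solvable (X P : lmodType R) (g : X -> P -> Prop)
    (L : seq (equation X P)) :
  pp_preserving g ->
  (forall q, q \in L -> g (\sum_(p <- q.1) p.1 *: p.2) q.2) ->
  exists u : X -> P, forall q, q \in L -> \sum_(p <- q.1) p.1 *: u p.2 = q.2.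
Proof.
move=> gP Lg; pose V := undup [seq p.2 | p <- flatten [seq q.1 | q <- L]].
have V_uniq : uniq V by apply: undup_uniq.
have LV q p : q \in L -> p \in q.1 -> p.2 \in V.
  move=> qL pq; rewrite mem_undup; apply/mapP; exists p => //.
  by apply/flatten_mapP; exists q.
(* The free variables are the right-hand sides, hence their coefficient - 1; the
   bound ones are the values of u at V. *)
pose phi : pp_formula R (size L) := PPFormula (- 1%:M)
  (\matrix_(e < size L, k < size V)
     \sum_(p <- (tnth (in_tuple L) e).1 | p.2 == tnth (in_tuple V) k) p.1).
have phi_free (N : lmodType R) (v : 'I_(size L) -> N) e :
    \sum_i pp_free phi e i *: v i = - v e.
  rewrite (bigD1 e) //= !mxE eqxx scaleN1r big1 ?addr0 // => i ie.
  by rewrite !mxE eq_sym (negbTE ie) oppr0 scale0r.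
have phi_bound (N : lmodType R) (w : 'I_(size V) -> N) (u : X -> N) e :
    (forall k, w k = u (tnth (in_tuple V) k)) ->
    \sum_j pp_bound phi e j *: w j =
    \sum_(p <- (tnth (in_tuple L) e).1) p.1 *: u p.2.
  move=> wu; set q := tnth _ e; have qL : q \in L by apply: mem_tnth.
  transitivity (\sum_(k < size V) \sum_(p <- q.1 | p.2 == tnth (in_tuple V) k)
      p.1 *: u p.2).
    apply: eq_bigr => k _; rewrite mxE scaler_suml.
    by apply: eq_bigr => p /eqP ->; rewrite wu.
  rewrite (exchange_big_dep xpredT) //= [LHS]big_seq [RHS]big_seq.
  apply: eq_bigr => p pq; have pV := LV q p qL pq.
  have pV' : (index p.2 V < size V)%N by rewrite index_mem.
  rewrite (big_pred1 (Ordinal pV')) // => k /=.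
  rewrite (tnth_nth p.2) /= -val_eqE /=.
  rewrite -{1}(nth_index p.2 pV) nth_uniq // ?ltn_ord // eq_sym //.
have [|w wP] := gP _ phi (fun e => \sum_(p <- (tnth (in_tuple L) e).1) p.1 *: p.2)
    (fun e => (tnth (in_tuple L) e).2) (fun e => Lg _ (mem_tnth e (in_tuple L))).
  by exists (tnth (in_tuple V)) => e; rewrite phi_free (phi_bound _ _ id) // addNr.
pose u x := if insub (index x V) is Some k then w k else 0.
exists u => q qL; have [e ->] : exists e, q = tnth (in_tuple L) e by apply/tnthP.
have := wP e; rewrite phi_free (phi_bound _ _ u).
  by move/eqP; rewrite addrC subr_eq0 => /eqP.
move=> k; rewrite /u (tnth_nth (tnth (in_tuple V) k)) /= index_uniq //.
by rewrite insubT //= => lt_k; congr w; apply: val_inj.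
Qed.

End PP.

(** The linear maps extending g are the solutions of a system with one unknown
    per element of X: its equations express linearity and membership in g.
    Finite subsystems are solvable, and the limit of solutions along the filter
    of finite subsystems solves all of them. *)
Lemma limits_pp_injective (R : pzRingType) (P : lmodType R) :
  has_limits P -> pp_injective P.
Proof.
move=> limP X g g0 gP.
pose valid (L : seq (equation X P)) :=
  forall q, q \in L -> g (\sum_(p <- q.1) p.1 *: p.2) q.2.
pose F : set_system (seq (equation X P)) :=
  filter_from valid (fun L0 => [set L | valid L /\ {subset L0 <= L}]).
have FF : ProperFilter F.
  apply: filter_from_proper => [|L vL]; last by exists L; split.
  apply: filter_from_filter; first by exists [::].
  move=> L1 L2 v1 v2; exists (L1 ++ L2).
    by move=> q; rewrite mem_cat => /orP[/v1|/v2].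
  move=> L [vL sL]; split; split=> // q qL; apply: sL; rewrite mem_cat qL //.
  exact: orbT.
have [lim limE] := limP _ F FF.
have /choice[u uP] L : exists u : X -> P, valid L ->
    forall q, q \in L -> \sum_(p <- q.1) p.1 *: u p.2 = q.2.
  have [vL|] := pselect (valid L); last by exists (fun=> 0).
  by have [u uP] := locally_solvable gP vL; exists u.
have solved s p : g (\sum_(x <- s) x.1 *: x.2) p ->
    \forall L \near F, \sum_(x <- s) x.1 *: u L x.2 = p.
  move=> gs; exists [:: (s, p)] => [q|L [vL sL]].
    by rewrite inE => /eqP ->.
  by apply: (uP _ vL (s, p)); apply: sL; rewrite inE.
have [|h hE] := linear_of (f := fun x => lim (fun L => u L x)).
  move=> r x y; apply/eqP; rewrite eq_sym -subr_eq0 -linearP -linearB.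
  apply/eqP/limE.
  (* Additivity and homogeneity at r, x, y as one equation, with right-hand side
     0; it is admissible because g relates 0 to 0. *)
  have := solved [:: (r, x); (1, y); (- 1, r *: x + y)] 0.
  rewrite !big_cons big_nil /= scaleN1r scale1r addr0 addrA subrr => /(_ g0).
  apply: filterS => L; rewrite !big_cons big_nil /= scaleN1r scale1r addr0 addrA.
  by move=> <-.
exists h => x p gxp; rewrite hE; apply: limE.
have := solved [:: (1, x)] p; rewrite big_seq1 /= scale1r => /(_ gxp).
by apply: filterS => L; rewrite big_seq1 /= scale1r.
Qed.

(** * The character bidual *)

Section Hom.
Variables U V : zmodType.

(** Additive maps, as a type with pointwise addition. *)
Record hom := Hom { hom_val :> U -> V;
  hom_valD : forall x y, hom_val (x + y) = hom_val x + hom_val y }.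

HB.instance Definition _ := gen_eqMixin hom.
HB.instance Definition _ := gen_choiceMixin hom.

Lemma hom_eq (f g : hom) : (forall x, f x = g x) -> f = g.
Proof.
case: f g => [f fD] [g gD] /= /funext fg; move: fD; rewrite fg => fD.
by congr Hom.
Qed.

Lemma hom0_subproof (x y : U) : (0 : V) = 0 + 0.
Proof. by rewrite addr0. Qed.
Lemma homN_subproof (f : hom) x y : - f (x + y) = - f x + - f y.
Proof. by rewrite hom_valD opprD. Qed.
Lemma homD_subproof (f g : hom) x y :
  f (x + y) + g (x + y) = (f x + g x) + (f y + g y).
Proof. by rewrite !hom_valD addrACA. Qed.

Definition hom0 := Hom hom0_subproof.
Definition homN f := Hom (homN_subproof f).
Definition homD f g := Hom (homD_subproof f g).

Lemma homDA : associative homD.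
Proof. by move=> f g h; apply: hom_eq => x /=; rewrite addrA. Qed.
Lemma homDC : commutative homD.
Proof. by move=> f g; apply: hom_eq => x /=; rewrite addrC. Qed.
Lemma hom0D : left_id hom0 homD.
Proof. by move=> f; apply: hom_eq => x /=; rewrite add0r. Qed.
Lemma homND : left_inverse hom0 homN homD.
Proof. by move=> f; apply: hom_eq => x /=; rewrite addNr. Qed.
HB.instance Definition _ := GRing.isZmodule.Build hom homDA homDC hom0D homND.

Lemma hom_val0 (f : hom) : f 0 = 0.
Proof. by apply: (addrI (f 0)); rewrite -hom_valD !addr0. Qed.

Lemma hom_val_sum (f : hom) I r (P : pred I) F :
  f (\sum_(i <- r | P i) F i) = \sum_(i <- r | P i) f (F i).
Proof. exact: (big_morph f (hom_valD f) (hom_val0 f)). Qed.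

Lemma hom_sumE I r (P : pred I) (F : I -> hom) x :
  (\sum_(i <- r | P i) F i) x = \sum_(i <- r | P i) F i x.
Proof. exact: (big_morph (fun f : hom => f x)). Qed.

End Hom.

Section Bidual.
Variables (R : pzRingType) (C : zmodType) (M : lmodType R).

Lemma dual_act_subproof (r : R) (c : hom M C) x y :
  c (r *: (x + y)) = c (r *: x) + c (r *: y).
Proof. by rewrite scalerDr hom_valD. Qed.
Definition dual_act r c : hom M C := Hom (dual_act_subproof r c).

(** The double character module: R acts on the right of the characters of M,
    hence on the left of their characters. *)
Definition bidual := hom (hom M C) C.
HB.instance Definition _ := GRing.Zmodule.on bidual.

Lemma bidual_scale_subproof r (f : bidual) c d :
  f (dual_act r (c + d)) = f (dual_act r c) + f (dual_act r d).
Proof. by rewrite -hom_valD; congr (f _); apply: hom_eq. Qed.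
Definition bidual_scale r (f : bidual) : bidual := Hom (bidual_scale_subproof r f).

Lemma bidual_scaleA a b (f : bidual) :
  bidual_scale a (bidual_scale b f) = bidual_scale (a * b) f.
Proof.
by apply: hom_eq => c /=; congr (f _); apply: hom_eq => x /=; rewrite scalerA.
Qed.
Lemma bidual_scale1 : left_id 1 bidual_scale.
Proof.
move=> f; apply: hom_eq => c /=; congr (f _).
by apply: hom_eq => x /=; rewrite scale1r.
Qed.
Lemma bidual_scaleDr : right_distributive bidual_scale +%R.
Proof. by move=> r f g; apply: hom_eq. Qed.
Lemma bidual_scaleDl (f : bidual) :
  {morph bidual_scale^~ f : a b / a + b >-> a + b}.
Proof.
move=> a b; apply: hom_eq => c /=; rewrite -hom_valD; congr (f _).
by apply: hom_eq => x /=; rewrite scalerDl hom_valD.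
Qed.
HB.instance Definition _ := GRing.Zmodule_isLmodule.Build R bidual
  bidual_scaleA bidual_scale1 bidual_scaleDr bidual_scaleDl.

Lemma bidual_eval_subproof (x : M) (c d : hom M C) : (c + d) x = c x + d x.
Proof. by []. Qed.
Definition bidual_eval x : bidual := Hom (bidual_eval_subproof x).

Hypothesis C_cogen : cogenerating C.

(** Limits are taken pointwise, at each character of M. *)
Lemma bidual_has_limits : has_limits bidual.
Proof.
move=> D F FF; have [L LE] := additive_limit C_cogen FF.
have lim_add (z : D -> bidual) (c d : hom M C) :
    L (fun t => z t (c + d)) = L (fun t => z t c) + L (fun t => z t d).
  by rewrite -raddfD; congr (L _); apply: funext => t; rewrite hom_valD.
have [|l lE] := linear_of (f := fun z : D -> bidual => Hom (lim_add z) : bidual).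
  by move=> r y z; apply: hom_eq => c /=; rewrite -raddfD.
exists l => z f zf; rewrite lE; apply: hom_eq => c /=; apply: LE.
by apply: filterS zf => t ->.
Qed.

(** If M does not satisfy [phi] at v, the column [x = pp_free phi * v] is not in
    the subgroup H of the columns [pp_bound phi * u].  A character f of columns
    that vanishes on H but not at x has coordinates c e, which are characters of
    M.  Witnesses w for the images of v in the double character module,
    evaluated at these coordinates, would give [f x = 0]. *)
Lemma bidual_eval_pure : exists f : {linear M -> bidual}, pure_embedding f.
Proof.
have [|ev evE] := linear_of (f := bidual_eval).
  by move=> r x y; apply: hom_eq => c /=; rewrite hom_valD.
exists ev; apply/pure_embeddingP => n phi v [w wP].
apply: contrapT => not_sat.
pose H : set ('I_(pp_neqs phi) -> M) :=
  [set y | exists u : 'I_(pp_nbound phi) -> M,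
     forall e, y e = \sum_j pp_bound phi e j *: u j].
pose x (e : 'I_(pp_neqs phi)) := \sum_i pp_free phi e i *: v i.
have [|y z [u uE] [u' u'E]|[u uE]|f [fH fx]] := hom_separation C_cogen (H := H) (x := x).
- by exists (fun=> 0) => e; rewrite big1 // => j _; rewrite scaler0.
- exists (fun j => u j - u' j) => e; rewrite !fctE uE u'E -sumrB.
  by apply: eq_bigr => j _; rewrite scalerBr.
- apply: not_sat; exists (fun j => - u j) => e.
  rewrite -/(x e) uE -big_split big1 //= => j _.
  by rewrite scalerN subrr.
pose single e (m : M) : 'I_(pp_neqs phi) -> M := fun e' => if e' == e then m else 0.
have singleD e m m' : f (single e (m + m')) = f (single e m) + f (single e m').
  rewrite -raddfD; congr (f _); apply: funext => e'; rewrite !fctE /single.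
  by case: ifP; rewrite ?addr0.
pose c e : hom M C := Hom (singleD e).
have fE y : f y = \sum_e c e (y e).
  rewrite /= -raddf_sum; congr (f _); apply: funext => e.
  rewrite fct_sumE (bigD1 e) //= /single eqxx big1 ?addr0 // => e' ee'.
  by rewrite eq_sym (negbTE ee').
have c_bound j : \sum_e dual_act (pp_bound phi e j) (c e) = 0.
  apply: hom_eq => m; rewrite hom_sumE.
  apply: etrans (fH (fun e => pp_bound phi e j *: m) _).
    by rewrite fE.
  exists (fun k => if k == j then m else 0) => e.
  rewrite (bigD1 j) //= eqxx big1 ?addr0 // => k kj.
  by rewrite (negbTE kj) scaler0.
case/eqP: fx; rewrite fE.
have wc e : c e (x e) + \sum_j w j (dual_act (pp_bound phi e j) (c e)) = 0.
  apply: etrans (congr1 (fun h : bidual => h (c e)) (wP e)).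
  have scaleE r (h : bidual) d : (r *: h) d = h (dual_act r d) by [].
  have -> (h k : bidual) : (h + k) (c e) = h (c e) + k (c e) by [].
  rewrite !hom_sumE /x hom_val_sum; congr (_ + _).
  by apply: eq_bigr => i _; rewrite scaleE /= evE.
transitivity (\sum_e c e (x e) +
              \sum_j w j (\sum_e dual_act (pp_bound phi e j) (c e))).
  by rewrite [X in _ + X]big1 ?addr0 // => j _; rewrite c_bound hom_val0.
have -> : \sum_j w j (\sum_e dual_act (pp_bound phi e j) (c e)) =
          \sum_j \sum_e w j (dual_act (pp_bound phi e j) (c e)).
  by apply: eq_bigr => j _; apply: hom_val_sum.
by rewrite exchange_big -big_split big1 //= => e _; apply: wc.
Qed.

End Bidual.

Lemma exists_pure_extension_with_limits (R : pzRingType) (M : lmodType R) :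
  exists (Q : lmodType R) (j : {linear M -> Q}), pure_embedding j /\ has_limits Q.
Proof.
have [j j_pure] := bidual_eval_pure M algU_cogenerating.
exists (bidual algU M : lmodType R), j; split=> //.
exact/bidual_has_limits/algU_cogenerating.
Qed.

(** * A minimal retract over a submodule *)

Section Retraction.
Variables (R : pzRingType) (M Q : lmodType R) (i : {linear M -> Q}).
Hypothesis Q_lim : has_limits Q.

Definition fixes_image (f : {linear Q -> Q}) := forall m, f (i m) = i m.

(** Endomorphisms are ordered by the pp-conditions that hold after applying
    them.  As g \o e is always above e, a maximal e is one for which further
    endomorphisms make no new pp-formula true on the image. *)
Definition pp_le (e f : {linear Q -> Q}) :=
  forall n (phi : pp_formula R n) (v : 'I_n -> Q), sat phi (e \o v) -> sat phi (f \o v).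

(** The pp-analogue of an essential extension of M.  For the formula
    [v_0 - v_1 = 0] it says that endomorphisms over M are injective on B. *)
Definition reflected (B : set Q) := forall f, fixes_image f ->
  forall n (phi : pp_formula R n) (v : 'I_n -> Q),
    (forall k, B (v k)) -> sat phi (f \o v) -> sat phi v.

(** The limit of the chain, taken pointwise, is again an endomorphism over M;
    a pp-formula that holds along the chain from some point on holds in the
    limit, with the limits of the witnesses. *)
Lemma pp_le_chain (A : set {linear Q -> Q}) : A !=set0 -> A `<=` fixes_image ->
  total_on A pp_le -> exists2 f, fixes_image f & forall e, A e -> pp_le e f.
Proof.
move=> A0 A_fix Atot.
pose F : set_system {linear Q -> Q} :=
  filter_from A (fun e => [set e' | A e' /\ pp_le e e']).
have le_trans (e f g : {linear Q -> Q}) : pp_le e f -> pp_le f g -> pp_le e g.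
  by move=> ef fg n phi v /ef /fg.
have FF : ProperFilter F.
  apply: filter_from_proper => [|e Ae]; last by exists e; split.
  apply: filter_from_filter => // e f Ae Af.
  have [ef|fe] := Atot e f Ae Af.
    by exists f => // g [Ag fg]; split; split=> //; apply: le_trans fg.
  by exists e => // g [Ag eg]; split; split=> //; apply: le_trans eg.
have [lim limE] := Q_lim FF.
have FA : \forall e \near F, A e by case: A0 => e Ae; exists e => // e' [].
have [|h hE] := linear_of (f := fun x => lim (fun e => e x)).
  move=> r x y; rewrite -linearP; congr (lim _); apply: funext => e.
  by rewrite linearP.
exists h; first by move=> m; rewrite hE; apply: limE; apply: filterS FA => e /A_fix.
move=> e0 Ae0 n phi v satv.
have F0 : F [set e : {linear Q -> Q} | sat phi (e \o v)]
  by exists e0 => // e [_]; apply.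
have /choice[w wP] (e : {linear Q -> Q}) : exists w : 'I_(pp_nbound phi) -> Q,
    sat phi (e \o v) -> forall k, \sum_i pp_free phi k i *: (e \o v) i +
      \sum_j pp_bound phi k j *: w j = 0.
  have [[w wP]|] := pselect (sat phi (e \o v)); first by exists w.
  by exists (fun=> 0).
exists (fun j => lim (fun e => w e j)) => k.
under eq_bigr do rewrite /= hE -linearZ.
under [X in _ + X]eq_bigr do rewrite -linearZ.
rewrite -!linear_sum -linearD; apply: limE; apply: filterS F0 => e /wP /(_ k) <-.
by rewrite fctE !fct_sumE.
Qed.

(** Choose e maximal for [pp_le]; by maximality the range of e is reflected.
    Choose B maximal among the reflected sets containing that range.  Since e
    reflects pp-formulas on B, the partial map sending e b to b extends to an
    endomorphism g, and g \o e is the identity on B.  As g \o e is again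
    maximal, its range is reflected and contains B, so it equals B, and g \o e
    is an idempotent with range B. *)
Lemma exists_retraction : exists e : {linear Q -> Q},
  [/\ fixes_image e, forall x, e (e x) = e x & reflected (range e)].
Proof.
have id_fix : fixes_image idfun by [].
have [[e e_fix] /= e_max] : exists e : {e : {linear Q -> Q} | fixes_image e},
    forall f : {f | fixes_image f}, pp_le (sval e) (sval f) -> pp_le (sval f) (sval e).
  apply: (@ZL_preorder_prop {e | fixes_image e} (exist _ _ id_fix)
            (fun e f => pp_le (sval e) (sval f))) => [e n phi v //|a b c ab bc|A A0 Atot].
    by move=> n phi v /ab /bc.
  have [|||f f_fix fP] := @pp_le_chain [set sval e | e in A].
  - by case: A0 => e Ae; exists (sval e); exists e.
  - by move=> _ [[e e_fix] _ <-].
  - by move=> _ _ [e Ae <-] [f Af <-]; apply: Atot.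
  - by exists (exist _ f f_fix) => e Ae; apply: fP; exists e.
have range_reflected (f : {linear Q -> Q}) :
    fixes_image f -> pp_le e f -> reflected (range f).
  move=> f_fix ef g g_fix n phi v vf.
  have /choice[u uE] k : exists u, f u = v k by have [u] := vf k; exists u.
  have -> : v = f \o u by apply: funext => k; rewrite /= uE.
  have gf_fix : fixes_image (g \o f) by move=> m /=; rewrite f_fix g_fix.
  move=> satg; apply: (ef); apply: (e_max (exist _ _ gf_fix)) => //.
  by move=> k psi x /ef /(sat_linear g).
pose P B := range i `<=` B /\ reflected B.
have [|F F0 FP Ftot|B [[iB refB] _ Bmax]] := @Zorn_above Q P (range e).
- split; last exact: range_reflected.
  by move=> _ [m _ <-]; exists (i m).
- split.
    by case: F0 => X FX x ix; exists X => //; have [+ _] := FP _ FX; apply.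
  move=> f f_fix n phi v vF.
  have [||||X FX vX] := @total_on_finite _ F subset n (fun k X => X (v k)).
  - exact: F0.
  - exact: Ftot.
  - by move=> k X Y; apply.
  - by move=> k; have [X FX Xv] := vF k; exists X.
  - by have [_ refX] := FP _ FX; apply: refX.
have [||g gE] := limits_pp_injective Q_lim (X := Q)
    (g := fun x y => B y /\ x = e y).
- by rewrite linear0; split=> //; apply: iB; exists 0; rewrite ?linear0.
- move=> n phi v w vw; have -> : v = e \o w by apply: funext => k; case: (vw k).
  by apply: refB => // k; case: (vw k).
have geB b : B b -> g (e b) = b by move=> Bb; apply: gE.
have ge_fix : fixes_image (g \o e) by move=> m /=; apply: geB; apply: iB; exists m.
have Brange : B `<=` range (g \o e) by move=> b Bb; exists b => //=; apply: geB.
have e_ge : pp_le e (g \o e) by move=> n phi v /(sat_linear g).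
have refge := range_reflected _ ge_fix e_ge.
exists (g \o e); split=> // x; apply: geB; apply: (Bmax (range (g \o e))) => //.
  by split=> //; apply: subset_trans Brange.
Qed.

End Retraction.

(** * Pure-injective envelopes *)

Section FixedPoints.
Variables (R : pzRingType) (Q : lmodType R) (e : {linear Q -> Q}).

(** The image of an idempotent is described as its set of fixed points, for
    which membership is decidable equality. *)
Definition fixed_pred : {pred Q} := fun x => e x == x.

Lemma fixed_submod_closed : submod_closed fixed_pred.
Proof.
split=> [|r x y]; rewrite !unfold_in /fixed_pred; first by rewrite linear0.
by move=> /eqP ex /eqP ey; rewrite linearP ex ey.
Qed.
HB.instance Definition _ := GRing.isSubmodClosed.Build R Q fixed_pred fixed_submod_closed.

Record fixed := Fixed { fixed_val : Q; fixedP : fixed_val \in fixed_pred }.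
HB.instance Definition _ := [isSub for fixed_val].
HB.instance Definition _ := [Choice of fixed by <:].
HB.instance Definition _ := [SubChoice_isSubLmodule of fixed by <:].

End FixedPoints.

Lemma idempotent_splits (R : pzRingType) (Q : lmodType R) (e : {linear Q -> Q}) :
  (forall x, e (e x) = e x) ->
  exists (P : lmodType R) (s : {linear P -> Q}) (r : {linear Q -> P}),
    (forall x, r (s x) = x) /\ (forall x, s (r x) = e x).
Proof.
move=> ee.
have [|s sE] := linear_of (f := @fixed_val R Q e).
  by move=> c x y; rewrite -[fixed_val _]/(val _) linearP.
have eP x : e x \in fixed_pred e by apply/eqP/ee.
have [|r rE] := linear_of (f := fun x => Fixed (eP x)).
  by move=> c x y; apply: val_inj; rewrite [RHS]linearP /= linearP.
exists (fixed e), s, r; split=> x; last by rewrite rE sE.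
by apply: val_inj; rewrite rE sE /=; apply/eqP; have := fixedP x.
Qed.

Lemma retract_has_limits (R : pzRingType) (P Q : lmodType R)
    (s : {linear P -> Q}) (r : {linear Q -> P}) :
  (forall x, r (s x) = x) -> has_limits Q -> has_limits P.
Proof.
move=> rs Q_lim D F FF; have [lim limE] := Q_lim D F FF.
have [|l lE] := linear_of (f := fun z : D -> P => r (lim (s \o z))).
  move=> a x y; rewrite -2!linearP; congr (r (lim _)); apply: funext => d /=.
  by rewrite !fctE /= linearP.
exists l => z c zc; rewrite lE (limE _ (s c)) ?rs //.
by apply: filterS zc => d /= ->.
Qed.

Lemma pp_injective_pure_injective (R : pzRingType) (P : lmodType R) :
  pp_injective P -> pure_injective P.
Proof.
move=> P_inj A B f g /pure_embeddingP f_pure.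
have [||h hE] := P_inj B (fun x y => exists a, f a = x /\ g a = y).
- by exists 0; rewrite !linear0.
- move=> n phi v w /choice[a aE] satv.
  have -> : w = g \o a by apply: funext => k; case: (aE k).
  apply/sat_linear/f_pure.
  by have <- : v = f \o a by apply: funext => k; case: (aE k).
- by exists h => a; apply: hE; exists a.
Qed.

(** Let P be the retract of Q given by [exists_retraction], with section s and
    retraction r.  For a pure k : M -> N the extension g : P -> N of k is pure:
    take h : N -> Q extending the embedding of M along k; then h \o g \o r is
    an endomorphism of Q over M, so it reflects pp-formulas on P, and hence so
    does g. *)
Lemma exists_pure_injective_envelope (R : pzRingType) (M : lmodType R) :
  exists (P : lmodType R) (i : {linear M -> P}),
    pure_injective_envelope i /\ pp_injective P.
Proof.
have [Q [j [j_pure Q_lim]]] := exists_pure_extension_with_limits M.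
have [e [ej ee e_refl]] := exists_retraction j Q_lim.
have [P [s [r [rs sr]]]] := idempotent_splits ee.
have P_lim := retract_has_limits rs Q_lim.
have P_inj := limits_pp_injective P_lim.
pose i : {linear M -> P} := r \o j.
have si m : s (i m) = j m by rewrite /= sr ej.
have i_pure : pure_embedding i.
  apply/pure_embeddingP => n phi v /(sat_linear s).
  have -> : s \o (i \o v) = j \o v by apply: funext => k; apply: si.
  by move/pure_embeddingP: j_pure; apply.
exists P, i; split=> //; split.
- exact: i_pure.
- exact: pp_injective_pure_injective.
move=> N k k_pure N_inj.
have [g gi] := N_inj _ _ i k i_pure; exists g => //.
have [h hk] := pp_injective_pure_injective (limits_pp_injective Q_lim) j k_pure.
have hgr_fix : fixes_image j (h \o (g \o r)) by move=> m; rewrite /= gi hk.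
apply/pure_embeddingP => n phi v satv.
have -> : v = r \o (s \o v) by apply: funext => l /=; rewrite rs.
apply: sat_linear; apply: (e_refl _ hgr_fix).
  by move=> l; exists (s (v l)) => //=; rewrite -sr rs.
have -> : h \o (g \o r) \o (s \o v) = h \o (g \o v).
  by apply: funext => l /=; rewrite rs.
exact: sat_linear.
Qed.

(** * Flatness of direct sums *)

Section Flat.
Variable R : pzRingType.

Lemma tensor_eq_map (A : lmodType R^c) (F F' : lmodType R) (g : {linear F -> F'})
    (s t : seq (A * F)) :
  tensor_eq s t ->
  tensor_eq [seq (p.1, g p.2) | p <- s] [seq (p.1, g p.2) | p <- t].
Proof.
elim=> {s t} /= [s|s t _ st|s t u _ st _ tu|s s' t t' _ ss' _ tt'|s t|x|a a' x
  |a x x'|r a x].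
- exact: tensor_refl.
- exact: tensor_sym.
- exact: tensor_trans tu.
- by rewrite !map_cat; apply: tensor_cat.
- by rewrite !map_cat; apply: tensor_comm.
- exact: tensor_zero.
- exact: tensor_addl.
- by rewrite linearD; apply: tensor_addr.
- by rewrite linearZ; apply: tensor_balanced.
Qed.

(** The decomposition of A (x) (P * Q) into A (x) P and A (x) Q, on formal
    sums. *)
Lemma tensor_eq_split (A : lmodType R^c) (P Q : lmodType R) (s : seq (A * (P * Q))) :
  tensor_eq s ([seq (p.1, (p.2.1, 0)) | p <- s] ++ [seq (p.1, (0, p.2.2)) | p <- s]).
Proof.
elim: s => [|[a [x y]] s IHs] /=; first exact: tensor_refl.
apply: (@tensor_trans _ _ _ _ ([:: (a, (x, 0)); (a, (0, y))] ++
  ([seq (p.1, (p.2.1, 0)) | p <- s] ++ [seq (p.1, (0, p.2.2)) | p <- s]))).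
  rewrite -cat1s; apply: tensor_cat IHs.
  have -> : (x, y) = (x, 0) + (0, y) :> P * Q by congr pair; rewrite ?addr0 ?add0r.
  exact: tensor_addr.
rewrite -[_ :: _ ++ _]cat1s -[[:: _; _]]cat1s -catA.
apply: tensor_cat; first exact: tensor_refl.
rewrite catA -[_ :: [seq (p.1, (0, p.2.2)) | p <- s]]cat1s catA.
by apply: tensor_cat; [apply: tensor_comm|apply: tensor_refl].
Qed.

(** Equality of two formal sums over P * Q can be checked on the two
    projections, where flatness of P and Q applies. *)
Lemma flat_prod (P Q : lmodType R) : flat P -> flat Q -> flat (P * Q)%type.
Proof.
move=> P_flat Q_flat A B f f_inj s t st.
have [|pr1 pr1E] := linear_of (f := fun x : P * Q => x.1); first by [].
have [|pr2 pr2E] := linear_of (f := fun x : P * Q => x.2); first by [].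
have [|in1 in1E] := linear_of (f := fun x : P => (x, 0 : Q)).
  by move=> r x y; congr pair; rewrite /= scaler0 addr0.
have [|in2 in2E] := linear_of (f := fun x : Q => (0 : P, x)).
  by move=> r x y; congr pair; rewrite /= scaler0 addr0.
have sub (F : lmodType R) (pr : {linear (P * Q)%type -> F}) : flat F ->
    tensor_eq [seq (p.1, pr p.2) | p <- s] [seq (p.1, pr p.2) | p <- t].
  move=> F_flat; apply: (F_flat A B f f_inj).
  by have := tensor_eq_map pr st; rewrite -!map_comp.
have split1 (u : seq (A * (P * Q))) : [seq (p.1, (p.2.1, 0 : Q)) | p <- u] =
    [seq (p.1, in1 p.2) | p <- [seq (p.1, pr1 p.2) | p <- u]].
  by rewrite -map_comp; apply: eq_map => p /=; rewrite in1E pr1E.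
have split2 (u : seq (A * (P * Q))) : [seq (p.1, (0 : P, p.2.2)) | p <- u] =
    [seq (p.1, in2 p.2) | p <- [seq (p.1, pr2 p.2) | p <- u]].
  by rewrite -map_comp; apply: eq_map => p /=; rewrite in2E pr2E.
apply: tensor_trans (tensor_eq_split s) _.
apply: tensor_trans _ (tensor_sym (tensor_eq_split t)).
rewrite !split1 !split2.
by apply: tensor_cat; apply/tensor_eq_map/sub.
Qed.

End Flat.

(** * Types *)

Section Types.
Variable R : pzRingType.

Lemma pp_typeP (A : Type) (N : lmodType R) (inc : A -> N) (b : seq N) p :
  pp_type inc b p <-> exists b_size : size b == ppo_arity p,
    pp_sat (ppo_formula p) (cat_tuple (Tuple b_size) (map_tuple inc (ppo_params p))).
Proof.
split=> [[x xb satx]|[b_size satb]]; last by exists (Tuple b_size).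
have b_size : size b == ppo_arity p by rewrite -xb size_tuple.
by exists b_size; have <- : x = Tuple b_size by apply: val_inj.
Qed.

Lemma pp_type_pure (A : Type) (N N' : lmodType R) (f : {linear N -> N'})
    (inc : A -> N) (b : seq N) :
  pure_embedding f -> pp_type (f \o inc) (map f b) = pp_type inc b.
Proof.
move=> [_ f_pure]; apply: funext => p; apply: propext.
have mapE n (h : size b == n) (h' : size (map f b) == n) k (c : k.-tuple A) :
    cat_tuple (Tuple h') (map_tuple (f \o inc) c) =
    map_tuple f (cat_tuple (Tuple h) (map_tuple inc c)).
  by apply: val_inj; rewrite /= map_cat -map_comp.
split=> /pp_typeP[h satb]; apply/pp_typeP.
  have h' : size b == ppo_arity p by rewrite -(size_map f).
  by exists h'; apply: f_pure; rewrite -(mapE _ _ h).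
have h' : size (map f b) == ppo_arity p by rewrite size_map.
exists h'; rewrite (mapE _ h); move/pp_satP: satb => /(sat_linear f) satb.
apply/pp_satP; set u := tnth _.
suff -> : u = f \o tnth (cat_tuple (Tuple h) (map_tuple inc (ppo_params p))) by [].
by apply: funext => i; rewrite /u tnth_map.
Qed.

Lemma pure_embedding_factor (M N P : lmodType R) (f : {linear M -> N})
    (g : {linear N -> P}) (h : {linear M -> P}) :
  (forall x, g (f x) = h x) -> pure_embedding h -> pure_embedding f.
Proof.
move=> gf /pure_embeddingP h_pure; apply/pure_embeddingP => n phi v.
move=> /(sat_linear g) satv; apply: h_pure.
by have <- : g \o (f \o v) = h \o v by apply: funext => k; apply: gf.
Qed.

Lemma Eat_pp_type (A : Type) (t1 t2 : triple R A) : Eat t1 t2 ->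
  pp_type (@tr_inc R A t1) (tr_tuple t1) = pp_type (@tr_inc R A t2) (tr_tuple t2).
Proof.
move=> [N [f1 [f2 [_ f1_pure f2_pure f12 b12]]]].
rewrite -(pp_type_pure _ _ f1_pure) -(pp_type_pure _ _ f2_pure) b12.
by congr pp_type; apply: funext.
Qed.

Lemma clos_trans_pp_type (A : Type) (t1 t2 : triple R A) :
  clos_trans _ (@Eat R A) t1 t2 ->
  pp_type (@tr_inc R A t1) (tr_tuple t1) = pp_type (@tr_inc R A t2) (tr_tuple t2).
Proof. by elim=> [s t /Eat_pp_type|s t u _ -> _ ->]. Qed.

Lemma Eat_sym (A : Type) (t1 t2 : triple R A) : Eat t1 t2 -> Eat t2 t1.
Proof. by move=> [N [f1 [f2 [? ? ? f12 b12]]]]; exists N, f2, f1; split. Qed.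

Lemma Eat_refl (A : Type) (t : triple R A) : Eat t t.
Proof.
have id_pure : pure_embedding (idfun : {linear tr_mod t -> tr_mod t}).
  by apply/pure_embeddingP.
by exists (tr_mod t), idfun, idfun; split=> //; apply: tr_flat.
Qed.

(** The formula [phi] with its i-th free variable renamed to the c i-th of k
    variables; c may identify variables, whose coefficients are then added. *)
Definition subst_pp n k (phi : pp_formula R n) (c : 'I_n -> 'I_k) : pp_formula R k :=
  PPFormula (\matrix_(e, l) \sum_(i | c i == l) pp_free phi e i) (pp_bound phi).

Lemma sat_subst_pp (N : lmodType R) n k (phi : pp_formula R n) (c : 'I_n -> 'I_k)
    (v : 'I_k -> N) : sat (subst_pp phi c) v <-> sat phi (v \o c).
Proof.
have E e : \sum_l pp_free (subst_pp phi c) e l *: v l =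
           \sum_i pp_free phi e i *: (v \o c) i.
  under eq_bigr do rewrite mxE scaler_suml.
  rewrite (exchange_big_dep xpredT) //=; apply: eq_bigr => i _.
  by rewrite (big_pred1 (c i)) // => l; rewrite eq_sym.
by split=> [[w wP]|[w wP]]; exists w => e; rewrite -[RHS](wP e) E.
Qed.

(** An entry of b1 beyond the length of b2 is matched with the default value 0;
    [pp_type_size] excludes this case when the pp-types agree. *)
Definition matched (A : Type) (N1 N2 : lmodType R) (inc1 : A -> N1) (inc2 : A -> N2)
    (b1 : seq N1) (b2 : seq N2) (x : N1) (y : N2) : Prop :=
  (exists a, x = inc1 a /\ y = inc2 a) \/
  (exists k : 'I_(size b1), x = b1`_k /\ y = b2`_k).

(** A formula about a tuple of matched elements becomes, by renaming variables,
    a formula about b1 with parameters, which is in the pp-type of b1 and hence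
    in that of b2.  The k-th entry of the tuple gets its own parameter slot,
    filled by the default a0 when the entry comes from b1. *)
Lemma matched_pp_preserving (A : Type) (N1 N2 : lmodType R) (inc1 : A -> N1)
    (inc2 : A -> N2) (b1 : seq N1) (b2 : seq N2) (a0 : A) :
  pp_type inc1 b1 `<=` pp_type inc2 b2 ->
  pp_preserving (matched inc1 inc2 b1 b2).
Proof.
move=> sub12 n phi v w vw satv.
have /choice[ac acE] j : exists p : A * 'I_(size b1 + n),
    p.2 = rshift _ j /\ (v j = inc1 p.1 /\ w j = inc2 p.1) \/
    exists2 k : 'I_(size b1), p.2 = lshift _ k & v j = b1`_k /\ w j = b2`_k.
  have [[a va]|[k vk]] := vw j.
    by exists (a, rshift _ j); left.
  by exists (a0, lshift _ k); right; exists k.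
pose a := [tuple (ac j).1 | j < n].
pose p := @PPOver R A (size b1) n (subst_pp phi (fun j => (ac j).2)) a.
(* The formula phi, its j-th variable replaced by an entry of the tuple b1 or by
   the j-th parameter. *)
have [|h /pp_satP/sat_subst_pp satw] := (pp_typeP inc2 b2 p).1 _.
  apply: sub12; apply/pp_typeP; exists (eqxx _); apply/pp_satP/sat_subst_pp.
  set u := _ \o _; suff -> : u = v by [].
  apply: funext => j; rewrite /u /=.
  have [[-> [-> _]]|[k -> [-> _]]] := acE j.
    by rewrite tnth_rshift !tnth_map tnth_ord_tuple.
  by rewrite tnth_lshift (tnth_nth 0).
move: satw; set u := _ \o _; suff -> : u = w by [].
apply: funext => j; rewrite /u /=.
have [[-> [_ ->]]|[k -> [_ ->]]] := acE j.
  by rewrite tnth_rshift !tnth_map tnth_ord_tuple.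
by rewrite tnth_lshift (tnth_nth 0).
Qed.

(** Tested on the formula with no equations, which is true of every tuple of the
    right length. *)
Lemma pp_type_size (A : Type) (N1 N2 : lmodType R) (inc1 : A -> N1)
    (inc2 : A -> N2) (b1 : seq N1) (b2 : seq N2) :
  pp_type inc1 b1 `<=` pp_type inc2 b2 -> size b2 = size b1.
Proof.
move=> sub12.
pose p := @PPOver R A (size b1) 0 (@PPFormula R _ 0 0 0 0) [tuple].
have [|/eqP h _] := (pp_typeP inc2 b2 p).1 _; last exact: h.
apply: sub12; apply/pp_typeP; exists (eqxx _).
by exists [tuple] => -[].
Qed.

(** Moves e along the matching: the relation that pairs x with e z whenever x is
    matched with z is pp-preserving, so it extends to a linear map. *)
Lemma extend_over_pp_type (M N1 N2 P : lmodType R) (i1 : {linear M -> N1})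
    (i2 : {linear M -> N2}) (b1 : seq N1) (b2 : seq N2) (e : {linear N2 -> P}) :
  pp_injective P -> pp_type i1 b1 `<=` pp_type i2 b2 ->
  exists g : {linear N1 -> P},
    (forall m, g (i1 m) = e (i2 m)) /\ map g b1 = map e b2.
Proof.
move=> P_inj sub12; have b_size := pp_type_size sub12.
have [||g gE] := P_inj N1 (fun x y => exists2 z, matched i1 i2 b1 b2 x z & e z = y).
- by exists 0; rewrite ?linear0 //; left; exists 0; rewrite !linear0.
- move=> n phi v w vw satv.
  have /choice[z zE] k : exists z, matched i1 i2 b1 b2 (v k) z /\ e z = w k.
    by have [z] := vw k; exists z.
  have -> : w = e \o z by apply: funext => k; case: (zE k).
  apply: sat_linear; apply: (matched_pp_preserving 0 sub12) satv => k.
  by case: (zE k).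
exists g; split=> [m|]; first by apply: gE; exists (i2 m) => //; left; exists m.
apply: (@eq_from_nth _ 0); rewrite !size_map // => k k_lt.
rewrite !(nth_map 0) ?b_size //; apply: gE; exists b2`_k => //.
by right; exists (Ordinal k_lt).
Qed.

End Types.

Theorem lemma4p4 (R : pzRingType)
    (env_flat : forall (M P : lmodType R) (i : {linear M -> P}),
       flat M -> pure_injective_envelope i -> flat P)
    (M N1 N2 : lmodType R)
    (M_flat : flat M) (N1_flat : flat N1) (N2_flat : flat N2)
    (i1 : {linear M -> N1}) (i2 : {linear M -> N2})
    (i1_pure : pure_embedding i1) (i2_pure : pure_embedding i2)
    (b1 : seq N1) (b2 : seq N2) :
  gtp N1_flat (proj1 i1_pure) b1 = gtp N2_flat (proj1 i2_pure) b2 <->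
  pp_type i1 b1 = pp_type i2 b2.
Proof.
split=> [gtp12|pp12].
  have : gtp N1_flat (proj1 i1_pure) b1 (Triple N2_flat (proj1 i2_pure) b2).
    by rewrite gtp12; apply/t_step/Eat_refl.
  exact: clos_trans_pp_type.
have [P1 [e1 [e1_env P1_inj]]] := exists_pure_injective_envelope N1.
have [P2 [e2 [e2_env P2_inj]]] := exists_pure_injective_envelope N2.
have [g1 [g1i g1b]] : exists g : {linear N2 -> P1},
    (forall m, g (i2 m) = e1 (i1 m)) /\ map g b2 = map e1 b1.
  by apply: extend_over_pp_type; rewrite ?pp12.
have [g2 [g2i g2b]] : exists g : {linear N1 -> P2},
    (forall m, g (i1 m) = e2 (i2 m)) /\ map g b1 = map e2 b2.
  by apply: extend_over_pp_type; rewrite ?pp12.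
have P12_flat : flat (P1 * P2)%type.
  by apply: flat_prod; [apply: env_flat e1_env|apply: env_flat e2_env].
have [|f1 f1E] := linear_of (f := fun x => (e1 x, g2 x)).
  by move=> r x y; rewrite !linearP.
have [|f2 f2E] := linear_of (f := fun x => (g1 x, e2 x)).
  by move=> r x y; rewrite !linearP.
have [|pr1 pr1E] := linear_of (f := fun x : P1 * P2 => x.1); first by [].
have [|pr2 pr2E] := linear_of (f := fun x : P1 * P2 => x.2); first by [].
have f1_pure : pure_embedding f1.
  have [e1_pure _ _] := e1_env.
  by apply: (pure_embedding_factor (g := pr1)) e1_pure => x; rewrite pr1E f1E.
have f2_pure : pure_embedding f2.
  have [e2_pure _ _] := e2_env.
  by apply: (pure_embedding_factor (g := pr2)) e2_pure => x; rewrite pr2E f2E.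
have E12 : Eat (Triple N1_flat (proj1 i1_pure) b1) (Triple N2_flat (proj1 i2_pure) b2).
  exists (P1 * P2)%type, f1, f2; split=> //=.
    by move=> m; rewrite f1E f2E g1i g2i.
  have b_size : size b1 = size b2 by rewrite -(size_map g2) g2b size_map.
  apply: (@eq_from_nth _ 0); rewrite !size_map // => k k_lt.
  rewrite !(nth_map 0) -?b_size // f1E f2E; congr pair.
    by rewrite -!(nth_map 0 0) -?b_size // g1b.
  by rewrite -!(nth_map 0 0) -?b_size // g2b.
apply: funext => t; apply: propext; split=> H.
  by apply: t_trans H; apply/t_step/Eat_sym.
by apply: t_trans H; apply: t_step.
Qed.
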